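(* Let $d\ge 1$ and let $\rho_{AB}$ be a density matrix on $\mathbb C^2\otimes\mathbb C^d$. Let $\mathcal U_A(\rho_{AB})=\min_{\vec n\in\mathbb R^3,\,|\vec n|=1}\mathcal I\big(\rho_{AB},(\vec n\cdot\vec\sigma)\otimes\mathbb I_B\big)$. Then $$\mathcal U_A(\rho_{AB})=1-\lambda_{\max}\{W_{AB}\},$$ where $\lambda_{\max}$ denotes the maximum eigenvalue and $W_{AB}$ is the $3\times 3$ symmetric matrix with elements $$(W_{AB})_{ij}=\mathrm{Tr}\left\{\rho_{AB}^{1/2}\,(\sigma_i\otimes\mathbb I_B)\,\rho_{AB}^{1/2}\,(\sigma_j\otimes\mathbb I_B)\right\},\qquad i,j\in\{x,y,z\}.$$
   Context: For a density matrix $\rho$ and a Hermitian operator $K$, the Wigner-Yanase skew information is $\mathcal I(\rho,K)=-\tfrac12\mathrm{Tr}\{[\rho^{1/2},K]^2\}$. Here $\vec\sigma=(\sigma_x,\sigma_y,\sigma_z)$ are the Pauli matrices acting on the first factor $\mathbb C^2$ (the qubit $A$), and $\vec n\cdot\vec\sigma=n_x\sigma_x+n_y\sigma_y+n_z\sigma_z$. The quantity $\mathcal U_A$ is the local quantum uncertainty for observables on the qubit $A$ with spectrum $\{1,-1\}$. *)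

(* Defs.v *)
From HB Require Import structures.
From mathcomp Require Import all_boot all_order all_algebra.
From mathcomp Require Import sesquilinear spectral.
From mathcomp Require Import complex mxtens.
From mathcomp Require Import boolp classical_sets reals.

Set Implicit Arguments.
Unset Strict Implicit.
Unset Printing Implicit Defensive.

Import Order.TTheory GRing.Theory Num.Theory.
Local Open Scope classical_set_scope.
Local Open Scope ring_scope.
Local Open Scope sesquilinear_scope.

(* On a numClosedFieldType, x <= y means that y - x is a nonnegative real; in  *)
(* particular lbound and ubound below force all elements compared to have the  *)
(* same imaginary part.  minimum and maximum are 0 when no least, respectively *)
(* greatest, element exists.                                                   *)
Section MinMax.
Context {C : numClosedFieldType}.
Implicit Types (A : set C) (m : C).

Definition is_min A m : Prop := A m /\ lbound A m.
Definition is_max A m : Prop := A m /\ ubound A m.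
Definition minimum A : C := xget 0 [set m | is_min A m].
Definition maximum A : C := xget 0 [set m | is_max A m].

Lemma minimumE A m : is_min A m -> minimum A = m.
Proof.
move=> [Am mA]; rewrite /minimum; case: xgetP => [x _ [Ax xA]|/(_ m)[]//].
by apply/le_anti; rewrite xA// mA.
Qed.

Lemma maximumE A m : is_max A m -> maximum A = m.
Proof.
move=> [Am mA]; rewrite /maximum; case: xgetP => [x _ [Ax xA]|/(_ m)[]//].
by apply/le_anti; rewrite xA// mA.
Qed.

End MinMax.

Section Matrices.
Context {C : numClosedFieldType}.

Definition psdmx n (A : 'M[C]_n) : Prop :=
  A \is hermsymmx /\ forall v : 'cV[C]_n, 0 <= (v ^t* *m A *m v) 0 0.

Definition density_matrix n (A : 'M[C]_n) : Prop := psdmx A /\ \tr A = 1.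

(* The square root by functional calculus, meaningful when A is psdmx: see     *)
(* sqrtmx_psd and sqrtmxK.                                                     *)
Definition sqrtmx n (A : 'M[C]_n) : 'M[C]_n :=
  invmx (spectralmx A) *m diag_mx (map_mx sqrtC (spectral_diag A))
    *m spectralmx A.

Definition commutator n (A B : 'M[C]_n) : 'M[C]_n := A *m B - B *m A.

Definition skew_information n (rho K : 'M[C]_n) : C :=
  - (1 / 2) * \tr (commutator (sqrtmx rho) K *m commutator (sqrtmx rho) K).

Definition lambda_max n (A : 'M[C]_n) : C := maximum [set a | eigenvalue A a].

Definition pauli_x : 'M[C]_2 := block_mx 0 1 1 0 :> 'M_(1 + 1).
Definition pauli_y : 'M[C]_2 := block_mx 0 (- 'i)%:M 'i%:M 0 :> 'M_(1 + 1).
Definition pauli_z : 'M[C]_2 := block_mx 1 0 0 (- 1) :> 'M_(1 + 1).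

(* The indices 0, 1, 2 stand for x, y, z. *)
Definition pauli (i : 'I_3) : 'M[C]_2 := [:: pauli_x; pauli_y; pauli_z]`_i.

Definition W_matrix d (rho : 'M[C]_(2 * d)) : 'M[C]_3 :=
  \matrix_(i, j) \tr (sqrtmx rho *m (pauli i *t (1%:M : 'M_d))
                        *m sqrtmx rho *m (pauli j *t (1%:M : 'M_d))).

Lemma psd_spectral_ge0 n (A : 'M[C]_n) :
  psdmx A -> forall i, 0 <= spectral_diag A 0 i.
Proof.
move=> [Ah A0] i.
have /orthomx_spectralP AE : A \is normalmx by exact: hermitian_normalmx.
have /unitarymxP PP := spectral_unitarymx A.
rewrite (invmx_unitary (spectral_unitarymx A)) in AE.
move: (spectralmx A) (spectral_diag A) PP AE => P D PP AE.
have := A0 (P ^t* *m delta_mx i 0).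
rewrite AE trmx_mul map_mxM /= trmxCK.
have -> (u : 'rV_n) (E : 'M_n) (w : 'cV_n) :
    u *m P *m (P ^t* *m E *m P) *m (P ^t* *m w) = u *m E *m w.
  by rewrite -!mulmxA (mulmxA P) PP mul1mx (mulmxA P) PP mul1mx.
by rewrite trmx_delta map_delta_mx -rowE -colE !mxE eqxx mulr1n.
Qed.

Lemma sqrtmx_psd n (A : 'M[C]_n) : psdmx A -> psdmx (sqrtmx A).
Proof.
move=> Apsd; have D0 := psd_spectral_ge0 Apsd.
have DE : (diag_mx (map_mx sqrtC (spectral_diag A))) ^t*
          = diag_mx (map_mx sqrtC (spectral_diag A)).
  rewrite tr_diag_mx map_diag_mx; congr diag_mx; apply/rowP => i.
  by rewrite !mxE; apply/CrealP/ger0_real; rewrite sqrtC_ge0.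
rewrite /sqrtmx (invmx_unitary (spectral_unitarymx A)); split.
  apply/is_hermitianmxP; rewrite expr0 scale1r.
  by rewrite !trmx_mul !map_mxM /= DE trmxCK mulmxA.
move=> v; rewrite !mulmxA -[_ *m spectralmx A *m v]mulmxA.
set w := spectralmx A *m v.
have -> : v ^t* *m (spectralmx A) ^t* = w ^t* by rewrite trmx_mul map_mxM.
rewrite mul_mx_diag mxE sumr_ge0// => i _; rewrite !mxE.
by rewrite mulrAC mulr_ge0 ?sqrtC_ge0// mulrC mul_conjC_ge0.
Qed.

Lemma sqrtmxK n (A : 'M[C]_n) : psdmx A -> sqrtmx A *m sqrtmx A = A.
Proof.
move=> [Ah _].
have /orthomx_spectralP AE : A \is normalmx by exact: hermitian_normalmx.
rewrite [RHS]AE /sqrtmx !mulmxA mulmxK ?spectral_unit//.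
rewrite -[_ *m diag_mx _ *m diag_mx _]mulmxA mulmx_diag.
congr (_ *m diag_mx _ *m _); apply/rowP => i.
by rewrite !mxE -expr2 sqrtCK.
Qed.

End Matrices.

Section LocalQuantumUncertainty.
Context {R : realType}.

(* The norm of the library on matrices is the maximum of the entries. *)
Definition euclidean_norm n (u : 'rV[R]_n) : R :=
  Num.sqrt (\sum_i u 0 i ^+ 2).

Definition spin_observable (n : 'rV[R]_3) : 'M[R[i]]_2 :=
  \sum_i (n 0 i)%:C%C *: pauli i.

Definition local_skew_informations d (rho : 'M[R[i]]_(2 * d)) : set R[i] :=
  [set skew_information rho (spin_observable n *t (1%:M : 'M_d))
     | n in [set n | euclidean_norm n = 1]].

Definition local_quantum_uncertainty d (rho : 'M[R[i]]_(2 * d)) : R[i] :=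
  minimum (local_skew_informations rho).

End LocalQuantumUncertainty.

(* Main.v *)
Require Import Defs.
From mathcomp Require Import all_boot all_order all_algebra.
From mathcomp Require Import sesquilinear spectral complex.
From mathcomp Require Import boolp classical_sets reals.
From mathcomp Require Import mxtens ring.
Import Order.TTheory GRing.Theory Num.Theory.
Local Open Scope classical_set_scope.
Local Open Scope ring_scope.
Local Open Scope sesquilinear_scope.

(** Since [(n . sigma)^2 = |n|^2], the skew information of [(n . sigma) (x) 1]
    is [|n|^2 - n W n^T].  Minimizing it over real unit vectors amounts to
    maximizing the quadratic form of [W], and the maximum is the largest
    eigenvalue because [W] is real symmetric. *)

Section Generic.
Context {C : numClosedFieldType}.

Lemma hermsymmxP n (A : 'M[C]_n) : reflect (A ^t* = A) (A \is hermsymmx).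
Proof.
by apply: (iffP (is_hermitianmxP _ _ _)); rewrite expr0 scale1r => /esym.
Qed.

(** In the coordinates [w = v *m P ^t*] of a unitary diagonalization, the form is the sum of the
    [D 0 k * |w_k|^2], so the largest diagonal entry bounds it; the matching row of [P] is an
    eigenvector. *)
Lemma hermitian_max_eigenvalue n (A : 'M[C]_n.+1) : A \is hermsymmx ->
  exists l, [/\ l \is Num.real, eigenvalue A l &
    forall v : 'rV[C]_n.+1,
      (v *m A *m v ^t*) 0 0 <= l * (v *m v ^t*) 0 0].
Proof.
move=> Ah.
have /mxOverP Dreal := hermitian_spectral_diag_real Ah.
have /orthomx_spectralP AE : A \is normalmx by exact: hermitian_normalmx.
have Punit := spectral_unit A.
have Pinv := invmx_unitary (spectral_unitarymx A).
move: (spectralmx A) (spectral_diag A) Dreal AE Punit Pinv.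
move=> P D Dreal AE Punit Pinv.
(* The order on [C] is partial: a largest entry exists because all entries of [D] are real, and
   [ord0] makes the index set nonempty. *)
have [i _ Dmax] := @real_arg_maxP _ _ ord0 predT (fun i => D 0 i)
  isT (fun i _ => Dreal 0 i).
exists (D 0 i); split=> //.
  apply/eigenvalueP; exists (row i P).
    rewrite {1}AE -row_mul !mulmxA mulmxV// mul1mx row_mul.
    by rewrite row_diag_mx -scalemxAl -rowE.
  (* An invertible matrix has no zero row: otherwise row [i] of [P *m Q = 1] would vanish. *)
  apply: contraTneq Punit => Pi0.
  rewrite -row_free_unit; apply/negP => /row_freeP[Q PQ].
  have /rowP/(_ i) := congr1 (row i) PQ.
  by rewrite row_mul Pi0 mul0mx !mxE eqxx => /eqP; rewrite eq_sym oner_eq0.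
move=> v; rewrite AE Pinv.
set w := v *m P ^t*.
have wE : w ^t* = P *m v ^t*.
  by rewrite /w trmx_mul map_mxM trmxCK.
have -> : v *m v ^t* = w *m w ^t*.
  by rewrite wE /w mulmxA -(mulmxA v) -Pinv mulVmx// mulmx1.
rewrite !mulmxA -/w -(mulmxA _ P) -wE mul_mx_diag !mxE mulr_sumr.
apply: ler_sum => k _; rewrite !mxE mulrAC [leLHS]mulrC ler_wpM2r//.
  exact: mul_conjC_ge0.
exact: Dmax.
Qed.

Lemma pauli_herm i : (pauli i : 'M[C]_2) ^t* = pauli i.
Proof.
case: i => [[|[|[|//]]] ?]; rewrite /pauli /= /pauli_x /pauli_y /pauli_z;
  rewrite (tr_block_mx (m1:=1) (m2:=1) (n1:=1) (n2:=1));
  rewrite (map_block_mx _ (m1:=1) (m2:=1) (n1:=1) (n2:=1)) /=;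
  rewrite ?linearN /= ?trmx0 ?trmx1 ?tr_scalar_mx ?map_mxN ?raddf0 ?raddf1;
  rewrite ?map_mx1 ?map_scalar_mx //=.
by rewrite rmorphN /= conjCi opprK.
Qed.

(** Pauli matrices square to 1 and distinct ones anticommute, so the cross terms cancel. This is
    checked by multiplying out in 1 by 1 blocks, with ['i ^+ 2 = -1] given to [ring]. *)
Lemma sqr_sum_pauli (c : 'I_3 -> C) :
  (\sum_i c i *: pauli i) *m (\sum_i c i *: pauli i) = (\sum_i c i ^+ 2)%:M.
Proof.
rewrite !big_ord_recl !big_ord0 /pauli/= !addr0 /pauli_x /pauli_y /pauli_z.
rewrite !(scale_block_mx (m1:=1) (m2:=1) (n1:=1) (n2:=1)).
rewrite !(add_block_mx (m1:=1) (m2:=1) (n1:=1) (n2:=1)).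
rewrite (mulmx_block (m1:=1) (m2:=1) (n1:=1) (n2:=1) (p1:=1) (p2:=1)).
rewrite [RHS](scalar_mx_block 1 1).
have sqrI := sqrCi C.
congr (block_mx (m1:=1) (m2:=1) (n1:=1) (n2:=1));
  apply/matrixP => a b; rewrite !ord1 !mxE ?big_ord1 !mxE /=; ring: sqrI.
Qed.

Lemma tensmx_suml I (r : seq I) m n p q (c : I -> C)
    (A : I -> 'M[C]_(m, n)) (B : 'M[C]_(p, q)) :
  (\sum_(i <- r) c i *: A i) *t B = \sum_(i <- r) c i *: (A i *t B).
Proof.
apply/matrixP => j k; case: (mxtens_indexP j) => a b.
case: (mxtens_indexP k) => e f; rewrite tensmxE !summxE mulr_suml.
by apply: eq_bigr => i _; rewrite !mxE !mxtens_indexK/= mulrA.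
Qed.

Lemma tensmx1 m n : (1%:M : 'M[C]_m) *t (1%:M : 'M_n) = 1%:M.
Proof.
apply/matrixP => i j; case: (mxtens_indexP i) => a b.
case: (mxtens_indexP j) => e f.
by rewrite tensmxE !mxE (can_eq (@mxtens_indexK _ _)) -natrM mulnb.
Qed.

(** The conjugate of a trace is the trace of the adjoint, which reverses the product; cyclicity does
    the rest. *)
Lemma mxtrace_conj_herm n (A B S : 'M[C]_n) :
  A ^t* = A -> B ^t* = B -> S ^t* = S ->
  (\tr (S *m A *m S *m B))^* = \tr (S *m B *m S *m A).
Proof.
move=> Ah Bh Sh; rewrite -trace_map_mx -mxtrace_tr map_trmx.
rewrite !trmx_mul !map_mxM/= Ah Bh Sh.
by rewrite !mulmxA mxtrace_mulC !mulmxA.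
Qed.

(** Of the four traces in the squared commutator, two contain [S *m S = rho] and reduce by cyclicity
    to [a * \tr rho = a]; the other two coincide. *)
Lemma skew_informationE n (rho K : 'M[C]_n) a : density_matrix rho ->
  K *m K = a%:M ->
  skew_information rho K = a - \tr (sqrtmx rho *m K *m sqrtmx rho *m K).
Proof.
move=> [rho_psd rho1] KK; rewrite /skew_information /commutator.
move: (sqrtmx rho) (sqrtmxK rho_psd) => S SS.
rewrite mulmxBl !mulmxBr !raddfB /= !mulmxA.
have -> : \tr (K *m S *m S *m K) = a.
  by rewrite -(mulmxA K) SS mxtrace_mulC mulmxA KK mul_scalar_mx
    mxtraceZ rho1 mulr1.
have -> : \tr (S *m K *m K *m S) = a.
  by rewrite mxtrace_mulC !mulmxA SS -mulmxA KK mul_mx_scalar mxtraceZ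
    rho1 mulr1.
have -> : \tr (K *m S *m K *m S) = \tr (S *m K *m S *m K).
  by rewrite mxtrace_mulC !mulmxA.
by field.
Qed.

(** The trace is bilinear in the two copies of [K], hence a plain transpose [c^T] without
    conjugation. *)
Lemma W_matrix_form d (rho : 'M[C]_(2 * d)) (c : 'rV[C]_3) :
  let K := \sum_i c 0 i *: (pauli i *t (1%:M : 'M_d)) in
  \tr (sqrtmx rho *m K *m sqrtmx rho *m K) = (c *m W_matrix rho *m c^T) 0 0.
Proof.
move=> K; rewrite [RHS]mxE.
rewrite {2}/K mulmx_sumr raddf_sum; apply: eq_bigr => j _.
rewrite -scalemxAr /= mxtraceZ [c^T _ _]mxE mulrC; congr (_ * _).
rewrite mxE /K mulmx_sumr !mulmx_suml raddf_sum; apply: eq_bigr => i _.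
by rewrite -scalemxAr -!scalemxAl /= mxtraceZ mxE.
Qed.

Lemma W_matrix_trmx d (rho : 'M[C]_(2 * d)) : (W_matrix rho)^T = W_matrix rho.
Proof.
apply/matrixP => i j; rewrite !mxE.
by rewrite -mulmxA mxtrace_mulC !mulmxA.
Qed.

(** Conjugating an entry swaps its indices, since all factors are Hermitian, and [W_matrix rho] is
    symmetric; so each entry is its own conjugate. *)
Lemma W_matrix_real d (rho : 'M[C]_(2 * d)) :
  psdmx rho -> W_matrix rho \is a realmx.
Proof.
move=> /sqrtmx_psd[/hermsymmxP Sh _].
have Kh i : (pauli i *t (1%:M : 'M[C]_d)) ^t* = pauli i *t 1%:M.
  by rewrite trmx_tens map_mxT/= pauli_herm trmx1 map_mx1.
apply/mxOverP => i j; apply/CrealP.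
by rewrite -[in RHS]W_matrix_trmx !mxE mxtrace_conj_herm.
Qed.

End Generic.

Section RealVectors.
Context {R : realType}.
Local Notation toC := (map_mx (real_complex R)).

Lemma euclidean_norm_eq1 n (u : 'rV[R]_n) :
  euclidean_norm u = 1 <-> \sum_i u 0 i ^+ 2 = 1.
Proof.
rewrite /euclidean_norm; split=> [u1|->]; last by rewrite sqrtr1.
by rewrite -[LHS]sqr_sqrtr ?u1 ?expr1n// sumr_ge0// => i _; rewrite sqr_ge0.
Qed.

Lemma toC_conj m n (u : 'M[R]_(m, n)) : (toC u) ^ Num.conj = toC u.
Proof. by apply/matrixP => i j; rewrite !mxE; exact: conjc_real. Qed.

Lemma toC_form n (u : 'rV[R]_n) :
  (toC u *m (toC u)^T) 0 0 = (\sum_i u 0 i ^+ 2)%:C%C.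
Proof.
by rewrite mxE rmorph_sum; apply: eq_bigr => i _; rewrite !mxE -expr2 rmorphXn.
Qed.

(** The directions to minimize over are real, so a complex eigenvector does not suffice. For real
    [A] and [l] its conjugate is again an eigenvector for [l], hence so is its real part when
    nonzero. *)
Lemma real_unit_eigenvector n (A : 'M[R[i]]_n) (l : R[i]) :
  A \is a realmx -> l \is Num.real -> eigenvalue A l ->
  exists u : 'rV[R]_n, euclidean_norm u = 1 /\ toC u *m A = l *: toC u.
Proof.
move=> Areal lreal /eigenvalueP[v vA v0].
have [{vA v0}w wA w0] : exists2 w : 'rV[R[i]]_n, w *m A = l *: w
    & map_mx (@complex.Re R) w != 0.
  have [Rev0|] := eqVneq (map_mx (@complex.Re R) v) 0; last by exists v.
  (* When the real part of [v] vanishes, ['i *: v] has real part minus the imaginary part of [v],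
     which is nonzero. *)
  exists ('i%C *: v); first by rewrite -scalemxAl vA !scalerA mulrC.
  apply: contraNneq v0 => Imv0; apply/eqP/rowP => i; rewrite mxE.
  have /rowP/(_ i) := Rev0; have /rowP/(_ i) := Imv0; rewrite !mxE.
  case: (v 0 i) => a b /=; rewrite mul0r mul1r add0r => /eqP.
  by rewrite oppr_eq0 => /eqP-> ->.
set x := map_mx (@complex.Re R) w in w0.
have xA : toC x *m A = l *: toC x.
  have -> : toC x = 2^-1 *: (w + map_mx Num.conj w).
    apply/rowP => i; rewrite !mxE mulrC -ReJ_add//.
  have wcA : map_mx Num.conj w *m A = l *: map_mx Num.conj w.
    rewrite -(realmxC Areal) -map_mxM wA map_mxZ/=; congr (_ *: _).
    exact/CrealP.
  by rewrite -scalemxAl mulmxDl wA wcA -scalerDr !scalerA mulrC.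
have x_gt0 : 0 < \sum_i x 0 i ^+ 2.
  rewrite lt_def sumr_ge0 ?andbT; last by move=> i _; rewrite sqr_ge0.
  apply: contra w0 => /eqP/psumr_eq0P x0; apply/eqP/rowP => i; rewrite [RHS]mxE.
  by apply/eqP; rewrite -sqrf_eq0 x0// => j _; rewrite sqr_ge0.
exists ((euclidean_norm x)^-1 *: x); split; last first.
  by rewrite map_mxZ/= -scalemxAl xA !scalerA mulrC.
apply/euclidean_norm_eq1.
under eq_bigr => i _ do rewrite mxE exprMn exprVn.
by rewrite -mulr_sumr /euclidean_norm sqr_sqrtr ?ltW// mulVf// gt_eqF.
Qed.

Lemma skew_information_spin d (rho : 'M[R[i]]_(2 * d)) (n : 'rV[R]_3) :
  density_matrix rho -> euclidean_norm n = 1 ->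
  skew_information rho (spin_observable n *t (1%:M : 'M_d))
    = 1 - (toC n *m W_matrix rho *m (toC n)^T) 0 0.
Proof.
move=> rhoD /euclidean_norm_eq1 n1.
have nE : spin_observable n = \sum_i toC n 0 i *: pauli i.
  by apply: eq_bigr => i _; rewrite mxE.
rewrite -W_matrix_form -tensmx_suml -nE; apply: skew_informationE => //.
rewrite tensmx_mul mulmx1 nE sqr_sum_pauli.
under eq_bigr => i _ do rewrite mxE -rmorphXn.
by rewrite -rmorph_sum n1 rmorph1 tensmx1.
Qed.

End RealVectors.

(** The [is_min] and [is_max] clauses rule out the default value 0 of [minimum] and [maximum], so
    the equation relates extrema that are attained. *)
Theorem mainTheorem2 (R : realType) (d : nat) (rho : 'M[R[i]]_(2 * d)) :
  (1 <= d)%N -> density_matrix rho ->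
  [/\ W_matrix rho \is a realmx /\ W_matrix rho \is symmetricmx,
      is_min (local_skew_informations rho) (local_quantum_uncertainty rho),
      is_max [set a | eigenvalue (W_matrix rho) a] (lambda_max (W_matrix rho))
    & local_quantum_uncertainty rho = 1 - lambda_max (W_matrix rho)].
Proof.
move=> _ rhoD; set W := W_matrix rho.
have Wreal : W \is a realmx by apply: W_matrix_real; case: rhoD.
have Wsym : W \is symmetricmx.
  by apply/is_hermitianmxP; rewrite expr0 scale1r map_mx_id// W_matrix_trmx.
have [l [lreal lW lmax]] :=
  hermitian_max_eigenvalue _ _ (realsym_hermsym Wsym Wreal).
have Wmax : is_max [set a | eigenvalue W a] l.
  split=> // a /eigenvalueP[v vW v0].
  (* On an eigenvector the bound reads [a * |v|^2 <= l * |v|^2], and [|v|^2] is positive. *)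
  have := lmax v; rewrite vW -scalemxAl mxE ler_pM2r// -dotmxE.
  exact: dotmx_is_dotmx.
have Umin : is_min (local_skew_informations rho) (1 - l).
  split.
    have [u [u1 uW]] := real_unit_eigenvector _ _ _ Wreal lreal lW.
    exists u => //; rewrite skew_information_spin// -/W uW -scalemxAl mxE.
    by rewrite toC_form; move/euclidean_norm_eq1: u1 => ->; rewrite mulr1.
  move=> _ [u u1 <-]; rewrite skew_information_spin// lerB// -/W.
  (* For a real vector the conjugate transpose is the transpose, so the Hermitian bound applies to
     the bilinear form. *)
  have := lmax (map_mx (real_complex R) u); rewrite map_trmx toC_conj -map_trmx toC_form.
  by move/euclidean_norm_eq1: u1 => ->; rewrite mulr1.
by rewrite /local_quantum_uncertainty /lambda_max (minimumE Umin) (maximumE Wmax).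
Qed.
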